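(* For each positive integer $N$, \[ \varphi_N(x,x^2,\ldots,x^N)=\sum_{\alpha\in\mathrm{OC}_{\le N}}(-1)^{\lfloor(\ell(\alpha)+1)/2\rfloor}x^{S_N(\alpha)}=\sum_{s=0}^{N(N+1)/2}c_s(N)x^s, \] where, writing $q_j,r_j$ for the quotient and remainder of $s$ upon division by $N+j$ ($j\in\{0,1\}$), \[ c_s(N)=\begin{cases}1 & s=0,\\ (-1)^{q_1+1}\binom{N-r_1}{q_1}\binom{q_1+r_1-\lfloor N/2\rfloor-1}{q_1} & \lfloor 2s/(N+1)\rfloor\text{ odd and } r_1>\lfloor N/2\rfloor,\\ (-1)^{q_0}\binom{r_0-1}{q_0-1}\binom{\lfloor N/2\rfloor-r_0+q_0}{q_0} & \lfloor 2s/(N+1)\rfloor\text{ even and } r_0\le\lfloor N/2\rfloor,\\ 0 & \text{otherwise.}\end{cases} \]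
   Context: An odd composition is a finite sequence of odd positive integers; $\mathrm{OC}_{\le N}$ is the set of odd compositions of integers in $\{0,\ldots,N\}$ (including the empty one); $\ell(\alpha)$ is the number of parts. $\sigma_N$ is the permutation of $\{1,\ldots,N\}$ with $\sigma_N(i)=i/2$ for $i$ even and $\sigma_N(i)=N+(1-i)/2$ for $i$ odd; $S_N(\alpha)=\sum_{i=1}^{\ell(\alpha)}\sigma_N(\alpha_1+\cdots+\alpha_i)$. The polynomial $\varphi_N(x_1,\ldots,x_N)=\sum_{\alpha\in\mathrm{OC}_{\le N}}(-1)^{\lfloor(\ell(\alpha)+1)/2\rfloor}\prod_{i=1}^{\ell(\alpha)}x_{\sigma_N(\alpha_1+\cdots+\alpha_i)}$. Binomial coefficients $\binom{n}{j}$ are $0$ when $j<0$ or when $n$ or $j$ is not an integer. *)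

(* Defs.v *)
From HB Require Import structures.
From mathcomp Require Import all_boot all_order all_algebra.
From mathcomp.multinomials Require Import mpoly.

Set Implicit Arguments.
Unset Strict Implicit.
Unset Printing Implicit Defensive.

Import Order.TTheory GRing.Theory Num.Theory.

Local Open Scope ring_scope.

Definition odd_comp (s : seq nat) : bool := all odd s.

Definition parts (N : nat) (a : N.-bseq 'I_N.+1) : seq nat :=
  [seq nat_of_ord i | i <- a].

(* A composition of an integer in {0, ..., N} has at most N parts, each of them
   at most N, so bounded sequences over 'I_N.+1 lose nothing (lemma OC_onto). *)
Definition OC (N : nat) : {set N.-bseq 'I_N.+1} :=
  [set a | odd_comp (parts a) & (sumn (parts a) <= N)%N].

Lemma parts_inj (N : nat) : injective (@parts N).
Proof. by move=> a b /(inj_map val_inj) /val_inj. Qed.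

Lemma OC_onto (N : nat) (s : seq nat) :
  odd_comp s -> (sumn s <= N)%N -> exists2 a, a \in OC N & parts a = s.
Proof.
move=> os sN.
have [szs les] : (size s <= sumn s)%N /\ {in s, forall x, x <= sumn s}%N.
  elim: s os {sN} => [|x s IHs] //= /andP[ox os].
  have [szs les] := IHs os; split.
    by case: x ox => // x _; rewrite addSn ltnS (leq_trans szs) ?leq_addl.
  move=> y; rewrite inE => /predU1P[->|/les les_y]; first exact: leq_addr.
  by rewrite (leq_trans les_y) ?leq_addl.
have szN : (size (map (@inord N) s) <= N)%N.
  by rewrite size_map (leq_trans szs).
have sE : parts (Bseq szN) = s.
  rewrite /parts /= -map_comp; apply: map_id_in => x /les lex /=.
  by rewrite inordK // ltnS (leq_trans lex).
by exists (Bseq szN); rewrite // inE sE os.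
Qed.

(* Truncated subtraction is exact here: i.-1./2 <= N for i in {1, ..., N}. *)
Definition sigma (N i : nat) : nat :=
  if odd i then (N - i.-1./2)%N else i./2.

(* sigma_N (alpha_1 + ... + alpha_i), with i counted from 1. *)
Definition sigma_part (N : nat) (s : seq nat) (i : nat) : nat :=
  sigma N (sumn (take i s)).

Definition S_ (N : nat) (s : seq nat) : nat :=
  (\sum_(1 <= i < (size s).+1) sigma_part N s i)%N.

(* x_k with k counted from 1 (0 when k is not in {1, ..., N}); it is the
   mpoly variable of index k - 1. *)
Definition xvar (N k : nat) : {mpoly int[N]} :=
  \sum_(i < N | i.+1 == k) 'X_i.

Definition phi (N : nat) : {mpoly int[N]} :=
  \sum_(a in OC N)
    (-1) ^+ (size (parts a)).+1./2 *
    \prod_(1 <= i < (size (parts a)).+1) xvar N (sigma_part N (parts a) i).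

(* n (n - 1) ... (n - k + 1) / k! for k >= 0 (the division is exact), and 0 for
   k < 0. *)
Definition binz (n k : int) : int :=
  match k with
  | Posz k => ((\prod_(i < k) (n - i%:Z)) %/ (k`!)%:Z)%Z
  | Negz _ => 0
  end.

Lemma binz_nat (n k : nat) : binz n%:Z k%:Z = ('C(n, k))%:Z.
Proof.
have -> : binz n k = ((n ^_ k)%:Z %/ (k`!)%:Z)%Z; last first.
  by rewrite -bin_ffact PoszM mulzK // -lt0n fact_gt0.
congr (_ %/ _)%Z; elim: k => [|k IHk]; first by rewrite big_ord0 ffactn0.
rewrite big_ord_recr /= IHk ffactnSr PoszM.
have [lekn|ltnk] := leqP k n; first by rewrite subzn.
by rewrite ffact_small // !mul0r.
Qed.

Definition c_ (N s : nat) : int :=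
  let q0 := (s %/ N)%N in let r0 := (s %% N)%N in
  let q1 := (s %/ N.+1)%N in let r1 := (s %% N.+1)%N in
  let h := N./2 in
  if s == 0%N then 1
  else if odd (2 * s %/ N.+1) && (h < r1)%N then
    (-1) ^+ q1.+1 * binz (N%:Z - r1%:Z) q1%:Z
      * binz (q1%:Z + r1%:Z - h%:Z - 1) q1%:Z
  else if ~~ odd (2 * s %/ N.+1) && (r0 <= h)%N then
    (-1) ^+ q0 * binz (r0%:Z - 1) (q0%:Z - 1)
      * binz (h%:Z - r0%:Z + q0%:Z) q0%:Z
  else 0.

(* Main.v *)
(* The partial sums p_1 < p_2 < ... of an odd composition alternate in parity,
   so writing p_(2i-1) = 2 k_i + 1 and p_(2i) = 2 m_i the exponent S_N is
   N * (number of odd partial sums) - \sum k_i + \sum m_i.  Splitting the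
   generating polynomial by the parity of the number of parts and letting the
   bound n on the size grow, a new position n can only extend the compositions
   of the opposite parity class.  By Pascal's rule this recursion is solved by
   [even_sum] (exponents q N + r with q <= r <= N/2) and [odd_sum] (exponents
   q (N+1) + r with N/2 < r <= N - q).  Euclidean division by N, respectively
   N + 1, recovers (q, r) from the exponent, and the two families are told apart
   by the parity of 2s/(N+1). *)

Require Import Defs.
From HB Require Import structures.
From mathcomp Require Import all_boot all_order all_algebra.
From mathcomp.multinomials Require Import mpoly.
From mathcomp Require Import zify ring.

Set Implicit Arguments.
Unset Strict Implicit.
Unset Printing Implicit Defensive.

Import Order.TTheory GRing.Theory Num.Theory.

Local Open Scope ring_scope.

(** * Odd compositions by size bound and parity of length *)

(** Raising the bound to n adds the compositions of exactly n, each recovered from what precedes its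
    last part. A sum of odd parts has the parity of their number, so the new ones lie in the class
    [b = odd n] and their truncations in the other class. *)
Fixpoint oddcomps (n : nat) (b : bool) : seq (seq nat) :=
  if n is m.+1 then
    oddcomps m b ++
    (if odd n == b then [seq rcons s (n - sumn s)%N | s <- oddcomps m (~~ b)]
     else [::])
  else if b then [::] else [:: [::]].

Lemma odd_sumn (s : seq nat) : odd_comp s -> odd (sumn s) = odd (size s).
Proof. by elim: s => //= x s IHs /andP[ox os]; rewrite oddD ox IHs. Qed.

Lemma mem_oddcomps (n : nat) (b : bool) (s : seq nat) :
  (s \in oddcomps n b) =
  [&& odd_comp s, (sumn s <= n)%N & odd (size s) == b].
Proof.
elim: n b s => [|n IHn] b s.
  rewrite /= leqn0; case: s => [|x s]; first by case: b.
  rewrite [RHS](_ : _ = false); first by case: b.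
  apply/negP => /and3P[/= /andP[ox _] + _].
  by rewrite addn_eq0; case: x ox.
rewrite [oddcomps _ _]/= -/(odd n.+1) mem_cat IHn.
apply/orP/and3P => [[/and3P[os le_sn sb]|]|[os le_sn /eqP sb]].
- by split=> //; exact: leqW.
- case: ifP => // /eqP nb /mapP[t].
  rewrite IHn => /and3P[ot le_tn /eqP tb] ->.
  have le_tSn := leqW le_tn; rewrite sumn_rcons size_rcons subnKC //.
  split=> //; last by rewrite /= tb negbK.
  by rewrite /odd_comp all_rcons -/(odd_comp t) ot oddB // nb odd_sumn // tb; case: b {nb tb}.
- have [le_sn'|lt_ns] := leqP (sumn s) n; first by left; apply/and3P; split=> //; apply/eqP.
  right; have eq_sn : sumn s = n.+1 by apply/eqP; rewrite eqn_leq le_sn.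
  rewrite -eq_sn odd_sumn // sb eqxx.
  case/lastP: s os sb eq_sn {le_sn lt_ns} => // t x.
  rewrite /odd_comp all_rcons -/(odd_comp t) => /andP[ox ot].
  rewrite size_rcons sumn_rcons => tb eq_tx.
  apply/mapP; exists t; last by rewrite addKn.
  rewrite IHn ot -tb /= negbK eqxx andbT /=.
  by rewrite -ltnS -eq_tx; case: x ox {eq_tx} => // x _; rewrite addnS ltnS leq_addr.
Qed.

Lemma oddcomps_uniq (n : nat) (b : bool) : uniq (oddcomps n b).
Proof.
elim: n b => [|n IHn] b; first by case: b.
rewrite [oddcomps _ _]/= cat_uniq IHn /=; case: ifP => // _.
apply/andP; split.
  apply/hasPn => _ /mapP[t + ->]; rewrite !mem_oddcomps => /and3P[_ le_tn _].
  by rewrite sumn_rcons subnKC ?leqW // ltnn andbF.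
by rewrite map_inj_uniq // => s t /rcons_inj[].
Qed.

Lemma sum_OC (N : nat) (R : zmodType) (F : seq nat -> R) :
  \sum_(a in OC N) F (parts a) =
  \sum_(s <- oddcomps N false) F s + \sum_(s <- oddcomps N true) F s.
Proof.
rewrite -big_cat /= -big_enum /= -(big_map (@parts N) xpredT F).
apply: perm_big; apply: uniq_perm.
- by rewrite map_inj_uniq ?enum_uniq //; exact: parts_inj.
- rewrite cat_uniq !oddcomps_uniq andbT /=; apply/hasPn => s.
  by rewrite !mem_oddcomps => /and3P[_ _ /eqP ->]; rewrite !andbF.
move=> s; rewrite mem_cat !mem_oddcomps -!andb_orr.
rewrite [X in _ && (_ && X)](_ : _ = true) ?andbT; last by case: odd.
apply/mapP/andP => [[a + ->]|[os sN]].
  by rewrite mem_enum inE => /andP.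
by have [a aO <-] := OC_onto os sN; exists a; rewrite // mem_enum.
Qed.

(** * Generating polynomials and their recursion *)

Definition comp_term (N : nat) (s : seq nat) : {poly int} :=
  (-1) ^+ (size s).+1./2 * 'X^(S_ N s).

Lemma S_rcons (N : nat) (s : seq nat) (x : nat) :
  S_ N (rcons s x) = (S_ N s + sigma N (sumn s + x))%N.
Proof.
rewrite /S_ size_rcons big_nat_recr //= /sigma_part.
rewrite take_oversize ?size_rcons // sumn_rcons; congr (_ + _)%N.
apply: eq_big_nat => i /andP[_ lt_is].
by rewrite -cats1 takel_cat.
Qed.

Lemma comp_term_rcons (N : nat) (s : seq nat) (x : nat) :
  comp_term N (rcons s x) =
  (-1) ^+ (~~ odd (size s)) * 'X^(sigma N (sumn s + x)) * comp_term N s.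
Proof.
rewrite /comp_term S_rcons size_rcons exprD.
(* The exponent of the sign grows by one exactly when the old number of parts is even. *)
have -> : (size s).+2./2 = (~~ odd (size s) + (size s).+1./2)%N.
  by rewrite /= !uphalf_half; case: odd; rewrite /= ?addn0 ?add0n ?add1n.
by rewrite exprD; ring.
Qed.

Definition gen (N n : nat) (b : bool) : {poly int} :=
  \sum_(s <- oddcomps n b) comp_term N s.

Lemma genS (N n : nat) (b : bool) :
  gen N n.+1 b = gen N n b +
    (if odd n.+1 == b then (-1) ^+ b * 'X^(sigma N n.+1) * gen N n (~~ b)
     else 0).
Proof.
rewrite /gen [oddcomps _ _]/= -/(odd n.+1) big_cat /=; congr (_ + _).
case: ifP => _; last by rewrite big_nil.
rewrite big_map mulr_sumr; apply: eq_big_seq => s.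
rewrite mem_oddcomps => /and3P[_ le_sn /eqP sb].
by rewrite comp_term_rcons sb negbK subnKC ?leqW.
Qed.

(** * Substituting powers of x in phi *)

Lemma mmap_xvar (N k : nat) : (0 < k <= N)%N ->
  mmap (@polyC int) (fun i : 'I_N => 'X^(i.+1)) (xvar N k) = 'X^k.
Proof.
case: k => // k lt_kN; rewrite /xvar.
rewrite (big_pred1 (Ordinal lt_kN)) => [|i]; last by rewrite /= eqSS -val_eqE.
by rewrite mmapX mmap1U.
Qed.

Lemma sigma_bound (N i : nat) : (0 < i <= N)%N -> (0 < sigma N i <= N)%N.
Proof. by rewrite /sigma; case: ifP; lia. Qed.

Lemma sumn_take_bound (s : seq nat) (i : nat) :
  odd_comp s -> (0 < i <= size s)%N -> (0 < sumn (take i s) <= sumn s)%N.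
Proof.
case: i s => // i [//|x s] /= /andP[ox _] _.
by rewrite addn_gt0 odd_gt0 //= leq_add2l -{2}(cat_take_drop i s) sumn_cat leq_addr.
Qed.

(** Partial sums lie in 1..N and [sigma] preserves this range, so each [xvar] that occurs is a
    genuine variable, never the default 0. *)
Lemma mmap_phi (N : nat) :
  mmap (@polyC int) (fun i : 'I_N => 'X^(i.+1)) (phi N) =
  \sum_(a in OC N) comp_term N (parts a).
Proof.
rewrite /phi rmorph_sum; apply: eq_bigr => a; rewrite inE => /andP[oa aN].
rewrite /comp_term rmorphM rmorphXn rmorphN1 rmorph_prod /S_ expr_sum; congr (_ * _).
apply: eq_big_nat => i lt_i; rewrite [LHS]mmap_xvar //; apply: sigma_bound.
by have /andP[-> /leq_trans->] := sumn_take_bound oa lt_i.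
Qed.

(** * Closed forms and their Pascal recursions *)

(* [q.+1] and [r.+1] are half the number of parts and \sum (m_i - k_i); the empty
   composition is the extra summand 1 of [even_sum]. *)
Definition even_coef (m q r : nat) : int :=
  (-1) ^+ q.+1 * ('C(r, q) * 'C(m + q - r, q.+1))%:R.

(* There are [q.*2.+1] parts, and [u] is k_1 + \sum (k_(i+1) - m_i). *)
Definition odd_coef (m q u : nat) : int :=
  (-1) ^+ q.+1 * ('C(u + q, q) * 'C(m.-1 - u, q))%:R.

Definition even_sum (N m : nat) : {poly int} :=
  1 + \sum_(0 <= q < N.+1) \sum_(0 <= r < m)
        even_coef m q r *: 'X^(q.+1 * N + r.+1).

Definition odd_sum (N m : nat) : {poly int} :=
  \sum_(0 <= q < N.+1) \sum_(0 <= u < m)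
    odd_coef m q u *: 'X^(q.+1 * N - u).

(** The substitution u = m - r aligns the exponents on both sides; what remains is Pascal's rule in
    the second binomial of [even_coef]. *)
Lemma even_sumS (N m : nat) : (m <= N)%N ->
  even_sum N m.+1 = even_sum N m + 'X^(m.+1) * odd_sum N m.+1.
Proof.
move=> le_mN; rewrite /even_sum /odd_sum -addrA; congr (_ + _).
rewrite mulr_sumr -big_split /=; apply: eq_big_nat => q _.
rewrite mulr_sumr [X in _ + X]big_nat_rev /= add0n.
have -> : \sum_(0 <= r < m) even_coef m q r *: 'X^(q.+1 * N + r.+1) =
    \sum_(0 <= r < m.+1) even_coef m q r *: 'X^(q.+1 * N + r.+1) :> {poly int}.
  by rewrite big_nat_recr //= /even_coef addKn (bin_small (ltnSn q)) muln0 mulr0 scale0r addr0.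
rewrite -big_split /=; apply: eq_big_nat => r /andP[_ lt_rm].
rewrite -scalerAr -exprD.
have -> : (m.+1 + (q.+1 * N - (m.+1 - r.+1)) = q.+1 * N + r.+1)%N by lia.
rewrite -scalerDl; congr (_ *: _); rewrite /even_coef /odd_coef -mulrDr -natrD.
rewrite subSS addSn subSn ?binS; last by lia.
have -> : (m - r + q = m + q - r)%N by lia.
have -> : (m.+1.-1 - (m - r) = r)%N by lia.
congr (_ * _%:R); rewrite mulnDr; congr addn; exact: mulnC.
Qed.

(** Layer q of [even_sum] feeds layer q + 1 of [odd_sum], through u = m - 1 - r and Pascal's rule in
    the second binomial of [odd_coef]. The summand 1 yields the composition with the single part 2m
    + 1. *)
Lemma odd_sumS (N m : nat) : (m <= N)%N ->
  odd_sum N m.+1 = odd_sum N m - 'X^(N - m) * even_sum N m.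
Proof.
move=> le_mN; rewrite /even_sum mulrDr mulr1 opprD addrA.
rewrite /odd_sum.
(* At u = m the factor binom(0, q) leaves only q = 0. *)
have -> : \sum_(0 <= q < N.+1) \sum_(0 <= u < m.+1)
    odd_coef m.+1 q u *: 'X^(q.+1 * N - u) =
  \sum_(0 <= q < N.+1) \sum_(0 <= u < m)
    odd_coef m.+1 q u *: 'X^(q.+1 * N - u) - 'X^(N - m) :> {poly int}.
  under eq_bigr do rewrite big_nat_recr //=.
  rewrite big_split /=; congr (_ + _).
  rewrite big_nat_recl // big1 ?addr0 => [|q _]; last first.
    by rewrite /odd_coef /= subnn bin0n muln0 mulr0 scale0r.
  by rewrite /odd_coef /= subnn !bin0 !mul1n mulr1 scaleN1r.
rewrite [RHS]addrAC; congr (_ - _).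
rewrite big_nat_recl // [X in _ = X - _]big_nat_recl // -addrA.
congr (_ + _); first by apply: eq_bigr => u _; rewrite /odd_coef !bin0.
(* The top layer q = N has no successor, but it vanishes: r < m <= N gives binom(r, N) = 0. *)
rewrite [X in _ = _ - _ * X]big_nat_recr //=.
rewrite [X in _ = _ - _ * (_ + X)]big1_seq ?addr0; last first.
  move=> r; rewrite mem_index_iota => /andP[_ /andP[_ lt_rm]].
  by rewrite /even_coef bin_small ?(leq_trans lt_rm) // mul0n mulr0 scale0r.
rewrite mulr_sumr -sumrB; apply: eq_big_nat => q _.
rewrite mulr_sumr [X in _ = _ - X]big_nat_rev /= add0n -sumrB.
apply: eq_big_nat => u /andP[_ lt_um].
rewrite -scalerAr -exprD.
have -> : (N - m + (q.+1 * N + (m - u.+1).+1) = q.+2 * N - u)%N by lia.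
rewrite -scalerBl; congr (_ *: _).
rewrite /even_coef /odd_coef [_ ^+ q.+2]exprS mulN1r !mulNr -opprD -mulrDr -natrD.
have -> : (m.+1.-1 - u = (m.-1 - u).+1)%N by lia.
have -> : (m - u.+1 = m.-1 - u)%N by lia.
have -> : (m + q - (m.-1 - u) = u + q.+1)%N by lia.
congr (- (_ * _%:R)); rewrite binS mulnDr; congr addn; exact: mulnC.
Qed.

(** * Solving the recursion *)

Lemma gen_stay (N n : nat) (b : bool) :
  odd n.+1 != b -> gen N n.+1 b = gen N n b.
Proof. by move=> nb; rewrite genS (negPf nb) addr0. Qed.

Lemma gen_step (N n : nat) (b : bool) : odd n.+1 = b ->
  gen N n.+1 b = gen N n b + (-1) ^+ b * 'X^(sigma N n.+1) * gen N n (~~ b).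
Proof. by move=> nb; rewrite genS nb eqxx. Qed.

(** Position 2m + 1 changes only the odd class, with [sigma] equal to N - m; position 2m + 2 changes
    only the even class, with [sigma] equal to m + 1. *)
Lemma gen_double (N m : nat) : (m <= N)%N ->
  [/\ gen N m.*2 false = even_sum N m, gen N m.*2 true = odd_sum N m,
      gen N m.*2.+1 false = even_sum N m
    & gen N m.*2.+1 true = odd_sum N m.+1].
Proof.
have step k : (k <= N)%N -> gen N k.*2 false = even_sum N k ->
    gen N k.*2 true = odd_sum N k ->
    gen N k.*2.+1 false = even_sum N k /\ gen N k.*2.+1 true = odd_sum N k.+1.
  move=> le_kN IHe IHo; have odd_k : odd k.*2.+1 by rewrite /= odd_double.
  split; first by rewrite gen_stay ?odd_k.
  rewrite (gen_step _ odd_k) IHe IHo (odd_sumS le_kN) expr1 mulN1r mulNr.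
  by congr (_ - 'X^_ * _); rewrite /sigma odd_k -pred_Sn doubleK.
elim: m => [|m IHm] lt_mN.
  have gen0 : gen N 0.*2 false = even_sum N 0 /\ gen N 0.*2 true = odd_sum N 0.
    rewrite /gen double0 [oddcomps _ _]/= big_seq1 /= big_nil /comp_term /S_ big_nil mulr1.
    rewrite /even_sum /odd_sum ![\sum_(0 <= q < _) _]big1 ?addr0 // => q _;
    by rewrite big_geq.
  by have [IHe IHo] := gen0; have [] := step 0 isT IHe IHo.
have [IHe IHo IHe' IHo'] := IHm (ltnW lt_mN).
have even_m : odd m.*2.+2 = false by rewrite /= odd_double.
have eE : gen N m.+1.*2 false = even_sum N m.+1.
  rewrite doubleS (gen_step _ even_m) IHe' IHo' (even_sumS (ltnW lt_mN)) expr0 mul1r.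
  by congr (_ + 'X^_ * _); rewrite /sigma even_m -doubleS doubleK.
have oE : gen N m.+1.*2 true = odd_sum N m.+1.
  by rewrite doubleS gen_stay ?even_m.
by have [] := step _ lt_mN eE oE.
Qed.

(** Among 1..N there are [N./2] even and [N - N./2] odd positions, whatever the parity of N. *)
Lemma gen_total (N : nat) :
  gen N N false + gen N N true = even_sum N N./2 + odd_sum N (N - N./2).
Proof.
have le_hN : (N./2 <= N)%N by lia.
have [IHe IHo IHe' IHo'] := gen_double le_hN.
have := odd_double_half N; case: (odd N) => /= defN.
  have -> : (N - N./2 = N./2.+1)%N by lia.
  by rewrite -IHe' -IHo'; congr (gen _ _ _ + gen _ _ _).
have -> : (N - N./2 = N./2)%N by lia.
by rewrite -IHe -IHo; congr (gen _ _ _ + gen _ _ _).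
Qed.

(** * Coefficients by Euclidean division *)

Lemma sum2_nat_single (R : nmodType) (a b q0 r0 : nat) (F : nat -> nat -> R) :
    (forall q r, (q < a)%N -> (r < b)%N -> (q, r) != (q0, r0) -> F q r = 0) ->
  \sum_(0 <= q < a) \sum_(0 <= r < b) F q r =
  if (q0 < a)%N && (r0 < b)%N then F q0 r0 else 0.
Proof.
move=> F0; case: ifPn => [/andP[lt_qa lt_rb]|out]; last first.
  rewrite big1_seq // => q; rewrite mem_index_iota => /andP[_ lt_q].
  rewrite big1_seq // => r; rewrite mem_index_iota => /andP[_ lt_r].
  by apply: F0 => //; apply: contra out => /eqP[<- <-]; apply/andP.
rewrite (bigD1_seq q0) ?iota_uniq ?mem_index_iota //=.
rewrite [X in _ + X]big1_seq ?addr0 => [|q]; last first.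
  rewrite mem_index_iota => /andP[nq lt_q]; rewrite big1_seq // => r.
  rewrite mem_index_iota => /andP[_ lt_r]; apply: F0 => //.
  by apply: contra nq => /eqP[->].
rewrite (bigD1_seq r0) ?iota_uniq ?mem_index_iota //=.
rewrite big1_seq ?addr0 // => r; rewrite mem_index_iota => /andP[nr lt_r].
by apply: F0 => //; apply: contra nr => /eqP[->].
Qed.

Lemma coef_sum2 (a b q0 r0 s : nat) (f : nat -> nat -> nat)
    (c : nat -> nat -> int) :
    (forall q r, (q < a)%N -> (r < b)%N -> s = f q r -> c q r != 0 ->
       (q, r) = (q0, r0)) ->
  (\sum_(0 <= q < a) \sum_(0 <= r < b) c q r *: 'X^(f q r))`_s =
  if (q0 < a)%N && (r0 < b)%N && (s == f q0 r0) then c q0 r0 else 0.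
Proof.
move=> inj; transitivity
    (\sum_(0 <= q < a) \sum_(0 <= r < b) c q r * (s == f q r)%:R).
  rewrite coef_sum; apply: eq_bigr => q _; rewrite coef_sum; apply: eq_bigr => r _.
  by rewrite coefZ coefXn.
rewrite (sum2_nat_single (q0 := q0) (r0 := r0)) => [|q r lt_q lt_r].
  by case: andP => //= _; case: eqP; rewrite ?mulr1 ?mulr0.
case: (s =P f q r) => [eq_s|_]; last by rewrite mulr0.
rewrite mulr1; have [//|nz] := eqVneq (c q r) 0.
by rewrite (inj q r) // eqxx.
Qed.

Lemma even_coef_neq0 (m q r : nat) : even_coef m q r != 0 -> (q <= r < m)%N.
Proof.
rewrite /even_coef mulf_eq0 signr_eq0 /= pnatr_eq0 -lt0n muln_gt0 !bin_gt0; lia.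
Qed.

Lemma odd_coef_neq0 (m q u : nat) :
  (u < m)%N -> odd_coef m q u != 0 -> (q + u < m)%N.
Proof.
rewrite /odd_coef mulf_eq0 signr_eq0 /= pnatr_eq0 -lt0n muln_gt0 !bin_gt0; lia.
Qed.

Lemma divn_mod_unique (d q r : nat) :
  (r < d)%N -> ((q * d + r) %/ d = q)%N /\ ((q * d + r) %% d = r)%N.
Proof.
move=> lt_rd; have d_gt0 : (0 < d)%N by lia.
by rewrite divnMDl // modnMDl divn_small // modn_small // addn0.
Qed.

(** A nonzero coefficient has r + 1 <= N/2 < N, so its exponent is already in divided form. If a
    quotient or remainder 0 is truncated by [.-1], the equality test rejects it. *)
Lemma coef_even_sum (N s : nat) (q := (s %/ N).-1) (r := (s %% N).-1) :
    (0 < N)%N ->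
  (even_sum N N./2)`_s = (s == 0)%:R +
    (if s == (q.+1 * N + r.+1)%N then even_coef N./2 q r else 0).
Proof.
move=> N_gt0; rewrite /even_sum coefD coef1; congr (_ + _).
rewrite (coef_sum2 (q0 := q) (r0 := r)) => [|q' r' _ lt_r defs _].
  case: (s == _); rewrite ?andbF // andbT; case: ifPn => // out; apply/esym/eqP.
  apply: contraR out => /even_coef_neq0 /andP[le_qr lt_rh].
  by rewrite lt_rh andbT; lia.
rewrite /q /r defs; have lt_rN : (r'.+1 < N)%N by lia.
by case: (divn_mod_unique q'.+1 lt_rN) => -> ->.
Qed.

(** Since (q+1)N - u = q(N+1) + (N - q - u), the remainder is N - q - u; it exceeds N/2 because
    nonzero coefficients have q + u < N - N/2. *)
Lemma coef_odd_sum (N s : nat) (q := (s %/ N.+1)%N) (r := (s %% N.+1)%N) :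
  (0 < N)%N ->
  (odd_sum N (N - N./2))`_s =
    if (N./2 < r)%N then
      (-1) ^+ q.+1 * ('C(N - r, q) * 'C(q + r - N./2 - 1, q))%:R
    else 0.
Proof.
move=> N_gt0; rewrite /odd_sum (coef_sum2 (q0 := q) (r0 := (N - q - r)%N)); last first.
  move=> q' u _ lt_u defs /(odd_coef_neq0 lt_u) lt_qu.
  have lt_rN : (N - q' - u < N.+1)%N by lia.
  have [] := divn_mod_unique q' lt_rN.
  have -> : (q' * N.+1 + (N - q' - u) = s)%N by rewrite defs; lia.
  by rewrite -/q -/r => -> ->; congr (_, _); lia.
have defs : s = (q * N.+1 + r)%N by exact: divn_eq.
have lt_rN : (r < N.+1)%N by exact: ltn_pmod.
case: (ltnP N./2 r) => [lt_hr|le_rh]; last first.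
  case: ifP => // /andP[/andP[_ lt_u] _]; apply/eqP.
  by apply: contraT => /(odd_coef_neq0 lt_u); lia.
have [le_qrN|lt_Nqr] := leqP (q + r) N.
  rewrite ifT; last by apply/andP; split; [|apply/eqP]; lia.
  rewrite /odd_coef; congr (_ * (_ * _)%:R); congr ('C(_, _)); lia.
(* Here u truncates to 0, and the exponent (q+1)N differs from s. *)
rewrite ['C(N - r, q)]bin_small ?mul0n ?mulr0; last by lia.
by rewrite ifF //; apply/negP => /andP[_ /eqP]; lia.
Qed.

(** * Comparison with the stated coefficients *)

Lemma odd_divn_double (N s : nat) :
  odd (2 * s %/ N.+1) = (N./2 < s %% N.+1)%N.
Proof.
have := ltn_pmod s (ltn0Sn N).
rewrite [X in (2 * X)%N](divn_eq s N.+1) mulnDr mulnA.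
rewrite divnMDl // oddD oddM /=; move: (s %% _)%N => r lt_rN.
case: ltnP => [lt_hr|le_rh]; last by rewrite divn_small //; lia.
have -> : (2 * r = 1 * N.+1 + (2 * r - N.+1))%N by lia.
by rewrite divnMDl // divn_small //; lia.
Qed.

Lemma coef_total (N s : nat) : (0 < N)%N ->
  (even_sum N N./2 + odd_sum N (N - N./2))`_s =
  if (s < (N * N.+1)./2.+1)%N then c_ N s else 0.
Proof.
move=> N_gt0; rewrite coefD coef_even_sum // coef_odd_sum //.
rewrite /c_ odd_divn_double andbb.
have [->|s_neq0] := eqVneq s 0%N; first by rewrite !mod0n addnS /= !addr0.
rewrite add0r.
have defs1 := divn_eq s N.+1; have lt_r1 := ltn_pmod s (ltn0Sn N).
have defs0 := divn_eq s N; have lt_r0 := ltn_pmod s N_gt0.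
set q1 := (s %/ N.+1)%N in defs1 *; set r1 := (s %% N.+1)%N in defs1 lt_r1 *.
set q0 := (s %/ N)%N in defs0 *; set r0 := (s %% N)%N in defs0 lt_r0 *.
have mod1 q r : (r < N.+1)%N -> s = (q * N.+1 + r)%N -> r1 = r.
  by move=> lt_r def_s; rewrite /r1 def_s; case: (divn_mod_unique q lt_r).
(* The families are disjoint: (q+1)N + r + 1 = (q+1)(N+1) + (r - q), whose remainder r - q is below
   N/2. *)
have even0 : (N./2 < r1)%N ->
    (if s == (q0.-1.+1 * N + r0.-1.+1)%N then even_coef N./2 q0.-1 r0.-1 else 0) = 0.
  move=> lt_hr; case: eqP => // defs; apply/eqP; apply: contraT.
  move/even_coef_neq0 => /andP[le_qr lt_rh].
  by have := mod1 q0.-1.+1 (r0.-1 - q0.-1)%N; lia.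
case: ltnP => [lt_hr|le_rh].
  rewrite even0 // add0r subzn; last by lia.
  have -> : q1%:Z + r1%:Z - (N./2)%:Z - 1 = (q1 + r1 - N./2 - 1)%N%:Z by lia.
  rewrite !binz_nat natrM !natz mulrA; case: ltnP => // gt_s.
  have [le_qrN|lt_Nqr] := leqP (q1 + r1) N; last first.
    by rewrite ['C(N - r1, q1)]bin_small ?mulr0 ?mul0r //; lia.
  (* Beyond degree N(N+1)/2 the formula must vanish; otherwise q1 <= N - r1 with r1 > N/2 bounds
     s. *)
  suff : (2 * s <= N * N.+1)%N by lia.
  have le_sN : (s <= q1.+1 * N)%N by lia.
  have : (2 * q1.+1 <= N.+1)%N by lia.
  by move/(leq_mul (leqnn N)); lia.
rewrite addr0 [~~ false]/= andTb; have [q0_eq0|q0_gt0] := posnP q0.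
  rewrite ifF; last by rewrite q0_eq0; apply/negP => /eqP; lia.
  by rewrite q0_eq0 [binz _ (0%:Z - 1)](_ : _ = 0) // mulr0 mul0r !if_same.
(* For r0 = 0 the factor [binz (-1) (q0 - 1)] is nonzero, so this branch of [c_] must be excluded: s
   = q0 N within the degree bound has remainder N + 1 - q0 > N/2 modulo N + 1. *)
have [r0_eq0|r0_gt0] := posnP r0.
  rewrite ifF; last by apply/negP => /eqP; rewrite r0_eq0 prednK //; lia.
  case: ltnP => // lt_s; have le_s : (2 * q0 * N <= N.+1 * N)%N by lia.
  rewrite leq_pmul2r // in le_s.
  have def_s : s = (q0.-1 * N.+1 + (N.+1 - q0))%N.
    rewrite [LHS]defs0 r0_eq0; move: q0_gt0 le_s; case: (q0) => // k _; lia.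
  by have := mod1 _ _ _ def_s; lia.
rewrite !prednK // -defs0 eqxx /even_coef prednK // natrM mulrA.
have [le_rh0|lt_hr0] := leqP r0 N./2; last first.
  rewrite if_same ['C(_ - _, q0)]bin_small ?mulr0 //; lia.
have [-> ->] : r0%:Z - 1 = r0.-1%:Z /\ q0%:Z - 1 = q0.-1%:Z by lia.
have -> : (N./2)%:Z - r0%:Z + q0%:Z = (N./2 + q0.-1 - r0.-1)%N%:Z by lia.
rewrite !binz_nat !natz; case: ltnP => // gt_s.
have [le_qr|lt_rq] := leqP q0 r0; last first.
  by rewrite ['C(r0.-1, _)]bin_small ?mulr0 ?mul0r //; lia.
(* Now q0 <= r0 <= N/2, whence s <= (N/2)(N+1). *)
suff : (2 * s <= N * N.+1)%N by lia.
have : (q0 * N.+1 <= N./2 * N.+1)%N by rewrite leq_mul2r; lia.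
have : (2 * N./2 * N.+1 <= N * N.+1)%N by rewrite leq_mul2r; lia.
have : (q0 * N + r0 <= N./2 * N + N./2)%N by rewrite leq_add // leq_mul2r; lia.
lia.
Qed.

Theorem theorem3p5 (N : nat) (N_gt0 : (0 < N)%N) :
  mmap (@polyC int) (fun i : 'I_N => 'X^(i.+1)) (phi N)
    = \sum_(a in OC N)
        (-1) ^+ (size (parts a)).+1./2 * 'X^(S_ N (parts a)) :> {poly int}
  /\
  \sum_(a in OC N)
      (-1) ^+ (size (parts a)).+1./2 * 'X^(S_ N (parts a))
    = \sum_(0 <= s < (N * N.+1)./2.+1) c_ N s *: 'X^s :> {poly int}.
Proof.
split; first exact: mmap_phi.
rewrite (sum_OC N (comp_term N)) gen_total; apply/polyP => s.
by rewrite coef_total // big_mkord -poly_def coef_poly.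
Qed.
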